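(* Let $k$ be a field of characteristic $2$, $(W,q)$ a finite-dimensional quadratic space over $k$, and $W=\mathrm{rad}(W)\perp W_1'$ with $W_1'$ a nonsingular subspace of maximal dimension. Let $(\rho,Y,\tau)\in\mathrm{O}(q,k)$ be an involution such that $\tau\in\mathrm{O}(q_{W_1'},k)$ and $\rho\in\mathrm{O}(q_{\mathrm{rad}(W)},k)$. Then $(\psi,Z,\mu)\in\mathrm{O}(q,k)$ is fixed by $\mathcal{I}_{(\rho,Y,\tau)}$ if and only if 1. $\psi$ is fixed by conjugation by $\rho$ in $\mathrm{O}(q_{\mathrm{rad}(W)},k)$; 2. $\mu$ is fixed by conjugation by $\tau\in\mathrm{O}(q_{W_1'},k)$; 3. $Z:W_1'\to\mathrm{rad}(W)$ is such that $q(w)=q(\mu(w))+q(Zw)$ for all $w\in W_1'$ and $$Y+\psi^{-1}Y\mu=Z+\rho Z\tau.$$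
   Context: $B$ is the polar form of $q$, $\mathrm{rad}(W)=\{x: B(x,w)=0\ \forall w\in W\}$, and $\mathrm{O}(q,k)$ is the group of linear automorphisms of $W$ preserving $q$; for a subspace $S$, $q_S$ is the restriction of $q$ to $S$. With respect to $W=\mathrm{rad}(W)\perp W_1'$, a triple $(\rho,Y,\tau)$, with $\rho\in\mathrm{GL}(\mathrm{rad}(W))$, $Y:W_1'\to\mathrm{rad}(W)$ linear and $\tau\in\mathrm{GL}(W_1')$, denotes the linear map with block matrix $\begin{bmatrix}\rho&\rho Y\\0&\tau\end{bmatrix}$, i.e. $g+w\mapsto \rho(g)+\rho(Yw)+\tau(w)$ for $g\in\mathrm{rad}(W)$, $w\in W_1'$. Every element of $\mathrm{O}(q,k)$ has this form. $\mathcal{I}_\sigma$ denotes conjugation by $\sigma$. An involution is an element of order $2$. *)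

(* Defs.v *)
From HB Require Import structures.
From mathcomp Require Import all_boot all_algebra.

Set Implicit Arguments.
Unset Strict Implicit.
Unset Printing Implicit Defensive.

Import GRing.Theory.
Local Open Scope ring_scope.

Section LinearAutomorphisms.
Variables (k : fieldType) (V : vectType k).
Implicit Types f g : 'End(V).

(* V is finite dimensional, so an injective endomorphism is an automorphism,
   with inverse f^-1%VF. *)
Definition general_linear f : Prop := lker f == 0%VS.

Definition involution f : Prop := f <> \1%VF /\ (f \o f)%VF = \1%VF.

Definition conjugation g f : 'End(V) := (g \o f \o g^-1)%VF.

End LinearAutomorphisms.

Section QuadraticForms.
Variables (k : fieldType) (V : vectType k).
Implicit Types (q : V -> k) (S : {vspace V}).

Definition polar q (x y : V) : k := q (x + y) - q x - q y.

Definition quadratic_form q : Prop :=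
  (forall a x, q (a *: x) = a ^+ 2 * q x) /\
  bilinear_for *%R *%R (polar q).

(* linfun (polar q e) is the linear form polar q e whenever q is quadratic;
   see memv_qrad. *)
Definition qrad q : {vspace V} :=
  (\bigcap_(e <- vbasis {:V}) lker (linfun (polar q e : V -> k^o)))%VS.

Definition orthogonal_group q (f : 'End(V)) : Prop :=
  general_linear f /\ forall x, q (f x) = q x.

Definition qrestr q S (x : subvs_of S) : k := q (vsval x).

Lemma memv_qrad q (x : V) : quadratic_form q ->
  reflect (forall w, polar q x w = 0) (x \in qrad q).
Proof.
case=> _ [bl br].
have sym u v : polar q u v = polar q v u by rewrite /polar (addrC u) addrAC.
have linp e : linear (polar q e : V -> k^o) by move=> a u v; exact: br.
have linE e u : linfun (polar q e : V -> k^o) u = polar q e u.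
  pose L := GRing.isLinear.Build _ _ _ _ (polar q e : V -> k^o) (linp e).
  pose F : {linear V -> k^o} := HB.pack (polar q e : V -> k^o) L.
  exact: (lfunE F u).
have memE : (x \in qrad q) = all (fun e => polar q e x == 0) (vbasis {:V}).
  rewrite /qrad; elim: (tval _) => [|e s IH]; first by rewrite big_nil memvf.
  by rewrite big_cons memv_cap IH memv_ker linE.
rewrite memE; apply: (iffP allP) => [h w | h e _]; last by rewrite sym h.
pose L := GRing.isLinear.Build _ _ _ _ (polar q x : V -> k^o) (linp x).
pose F : {linear V -> k^o} := HB.pack (polar q x : V -> k^o) L.
rewrite -[polar q x w]/(F w) (coord_vbasis (memvf w)) linear_sum big1 // => i _.
have hi : F (vbasis {:V})`_i = 0.
  by rewrite /F /= sym; apply/eqP/h/mem_nth; rewrite size_tuple.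
by rewrite linearZ [F _]hi; exact: mulr0.
Qed.

End QuadraticForms.

Section Decomposition.
Variables (k : fieldType) (V : vectType k).
Implicit Types (q : V -> k) (S T : {vspace V}).

Definition nonsingular q S : Prop := qrad (qrestr q (S := S)) = 0%VS.

Definition max_nonsingular q S : Prop :=
  nonsingular q S /\ forall T, nonsingular q T -> (\dim T <= \dim S)%N.

Definition orthogonal_sum q S T : Prop :=
  [/\ (S + T)%VS = fullv, (S :&: T)%VS = 0%VS
    & forall x y, x \in S -> y \in T -> polar q x y = 0].

(* The map s + t |-> rho s + rho (Y t) + tau t on the direct sum V = S + T;
   see block_mapE. *)
Definition block_map S T (rho : 'End(subvs_of S))
    (Y : 'Hom(subvs_of T, subvs_of S)) (tau : 'End(subvs_of T)) : 'End(V) :=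
  let piS := (linfun (vsproj S) \o daddv_pi S T)%VF in
  let piT := (linfun (vsproj T) \o daddv_pi T S)%VF in
  (linfun vsval \o rho \o piS)%VF + (linfun vsval \o rho \o Y \o piT)%VF
  + (linfun vsval \o tau \o piT)%VF.

Lemma block_mapE S T rho Y tau (s : subvs_of S) (t : subvs_of T) :
  (S :&: T)%VS = 0%VS ->
  block_map rho Y tau (vsval s + vsval t) =
    vsval (rho s) + vsval (rho (Y t)) + vsval (tau t).
Proof.
move=> ST; have TS : (T :&: S)%VS = 0%VS by rewrite capvC.
have pi0 (A B : {vspace V}) v :
    (A :&: B)%VS = 0%VS -> v \in B -> daddv_pi A B v = 0.
  move=> AB vB; have BA : (B :&: A)%VS = 0%VS by rewrite capvC.
  have vAB : v \in (A + B)%VS by apply: subvP vB; exact: addvSr.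
  move: (daddv_pi_add AB vAB); rewrite (daddv_pi_id BA vB).
  by move/(canRL (addrK _)) => ->; rewrite subrr.
rewrite /block_map !add_lfunE !comp_lfunE !lfunE /= !linearD /=.
rewrite (daddv_pi_id ST (subvsP s)) (daddv_pi_id TS (subvsP t)).
rewrite (pi0 _ _ _ ST (subvsP t)) (pi0 _ _ _ TS (subvsP s)).
by rewrite !linear0 !addr0 !add0r !vsvalK.
Qed.

End Decomposition.

(* Main.v *)
(* Block maps multiply by
   (rho, Y, tau)(psi, Z, mu) = (rho psi, Z + psi^-1 Y mu, tau mu),
   and the blocks of such a map are determined by it as soon as its first block
   is injective.  Being fixed by conjugation means commuting, so comparing the
   blocks of both products gives the three commutation relations; here
   rho^-1 = rho because the map is an involution, and Y and Z may change sides
   in characteristic 2.  The condition on q in 3 and the orthogonality of psi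
   hold for every isometry (psi, Z, mu), since rad(W) is B-orthogonal to W. *)
Require Import Defs.
From mathcomp Require Import all_boot all_algebra.

Set Implicit Arguments.
Unset Strict Implicit.
Unset Printing Implicit Defensive.

Import GRing.Theory.
Local Open Scope ring_scope.

Section BlockMaps.
Variables (k : fieldType) (V : vectType k).

Lemma oppv_pchar2 (U : lmodType k) (v : U) : 2%N \in [pchar k] -> - v = v.
Proof.
move=> char2; apply/eqP; rewrite eq_sym -subr_eq0 opprK -mulr2n -scaler_nat.
by rewrite (pcharf0 char2) scale0r.
Qed.

Lemma conjugation_fixP (g f : 'End(V)) : general_linear g ->
  conjugation g f = f <-> (g \o f)%VF = (f \o g)%VF.
Proof.
move=> g_inj; rewrite /conjugation; split=> [{2}<- | ->].
  by rewrite -[RHS]comp_lfunA lker0_compVf // comp_lfun1r.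
by rewrite -comp_lfunA lker0_compfV // comp_lfun1r.
Qed.

Variables S T : {vspace V}.
Hypotheses (ST_full : (S + T)%VS = fullv) (ST0 : (S :&: T)%VS = 0%VS).
Implicit Types (rho psi : 'End(subvs_of S)) (tau mu : 'End(subvs_of T)).
Implicit Types (Y Z : 'Hom(subvs_of T, subvs_of S)).

Lemma direct_sum_lfunP (f g : 'End(V)) :
  (forall (s : subvs_of S) (t : subvs_of T),
     f (vsval s + vsval t) = g (vsval s + vsval t)) -> f = g.
Proof.
move=> fg; apply/lfunP=> v.
have /memv_addP[x xS [y yT ->]] : v \in (S + T)%VS by rewrite ST_full memvf.
by have := fg (vsproj S x) (vsproj T y); rewrite !vsprojK.
Qed.

(** The vector [s - s'] equals [t' - t], so it lies in the intersection of [S] and [T], which is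
    zero. *)
Lemma direct_sum_vsval_inj (s s' : subvs_of S) (t t' : subvs_of T) :
  vsval s + vsval t = vsval s' + vsval t' -> s = s' /\ t = t'.
Proof.
move=> e; have e' : vsval (s - s') = vsval (t' - t).
  by rewrite !linearB /=; apply/eqP; rewrite subr_eq addrAC
    eq_sym subr_eq e addrC.
have d0 : vsval (s - s') = 0.
  by apply/eqP; rewrite -memv0 -ST0 memv_cap subvsP e' subvsP.
split; apply/eqP; first by rewrite -subr_eq0 -(inj_eq subvs_inj) d0 linear0.
by rewrite eq_sym -subr_eq0 -(inj_eq subvs_inj) -e' d0 linear0.
Qed.

(** Vectors of [S] determine the first block. Vectors of [T] then only determine [rho \o Y], from
    which injectivity of [rho] recovers [Y]. *)
Lemma block_map_inj rho psi Y Z tau mu : general_linear rho ->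
  block_map rho Y tau = block_map psi Z mu -> [/\ rho = psi, Y = Z & tau = mu].
Proof.
move=> rho_inj e.
have e2 s t : rho s + rho (Y t) = psi s + psi (Z t) /\ tau t = mu t.
  apply: direct_sum_vsval_inj; rewrite !linearD /= -!block_mapE //.
  by rewrite e.
have rho_psi : rho = psi.
  by apply/lfunP=> s; have [] := e2 s 0; rewrite !linear0 !addr0.
split=> //; apply/lfunP=> t; last by case: (e2 0 t).
have [] := e2 0 t; rewrite -rho_psi !linear0 !add0r => rhoYZ _.
exact: (lker0P rho_inj).
Qed.

Lemma block_map1 : block_map \1 (0 : 'Hom(subvs_of T, subvs_of S)) \1 = \1%VF.
Proof.
apply: direct_sum_lfunP => s t.
by rewrite block_mapE // !id_lfunE zero_lfunE linear0 addr0.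
Qed.

(** On [t] in [T] the [S]-component of the product is [rho (psi (Z t)) + rho (Y (mu t))]. Factoring
    out [rho \o psi] puts [psi^-1] in front of [Y]. *)
Lemma block_map_comp rho psi Y Z tau mu : general_linear psi ->
  (block_map rho Y tau \o block_map psi Z mu)%VF =
  block_map (rho \o psi) (Z + (psi^-1 \o Y \o mu)%VF) (tau \o mu).
Proof.
move=> psi_inj; apply: direct_sum_lfunP => s t.
rewrite comp_lfunE !block_mapE // -linearD block_mapE // !(comp_lfunE, add_lfunE).
by rewrite !linearD /= lker0_lfunVK // !addrA.
Qed.

End BlockMaps.

Theorem proposition6p6 (k : fieldType) (char_k : 2%N \in [pchar k])
  (W : vectType k) (q : W -> k) (quad_q : quadratic_form q)
  (W1 : {vspace W}) (W1_max : max_nonsingular q W1)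
  (W_sum : orthogonal_sum q (qrad q) W1)
  (rho : 'End(subvs_of (qrad q))) (Y : 'Hom(subvs_of W1, subvs_of (qrad q)))
  (tau : 'End(subvs_of W1))
  (sigma_O : orthogonal_group q (block_map rho Y tau))
  (sigma_inv : involution (block_map rho Y tau))
  (tau_O : orthogonal_group (qrestr q (S := W1)) tau)
  (rho_O : orthogonal_group (qrestr q (S := qrad q)) rho)
  (psi : 'End(subvs_of (qrad q))) (psi_GL : general_linear psi)
  (Z : 'Hom(subvs_of W1, subvs_of (qrad q)))
  (mu : 'End(subvs_of W1)) (mu_GL : general_linear mu)
  (phi_O : orthogonal_group q (block_map psi Z mu)) :
  conjugation (block_map rho Y tau) (block_map psi Z mu) = block_map psi Z mu
  <->
  [/\ orthogonal_group (qrestr q (S := qrad q)) psi /\ conjugation rho psi = psi,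
      conjugation tau mu = mu
    & (forall w : subvs_of W1, q (vsval w) = q (vsval (mu w)) + q (vsval (Z w)))
      /\ Y + (psi^-1 \o Y \o mu)%VF = Z + (rho \o Z \o tau)%VF].
Proof.
have [full cap0 _] := W_sum.
have [rho_GL q_rho] := rho_O; have [tau_GL _] := tau_O.
have [sigma_GL _] := sigma_O; have [_ q_phi] := phi_O.
have rho_psi_GL : general_linear (rho \o psi)%VF.
  by apply/lker0P=> x y; rewrite !comp_lfunE => /(lker0P rho_GL)/(lker0P psi_GL).
have rho_inv : (rho^-1)%VF = rho.
  (* With the identity written as a block map, the first block of the squared involution reads
     [rho \o rho = \1]. *)
  have [_] := sigma_inv; rewrite block_map_comp // -(block_map1 full cap0).
  have rho_rho_GL : general_linear (rho \o rho)%VF.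
    by apply/lker0P=> x y; rewrite !comp_lfunE => /(lker0P rho_GL)/(lker0P rho_GL).
  case/(block_map_inj cap0 rho_rho_GL) => rho2 _ _.
  by rewrite -[LHS]comp_lfun1r -rho2 comp_lfunA lker0_compVf // comp_lfun1l.
have Y_Z : Z + (psi^-1 \o Y \o mu)%VF = Y + (rho \o Z \o tau)%VF <->
           Y + (psi^-1 \o Y \o mu)%VF = Z + (rho \o Z \o tau)%VF.
  set A := (psi^-1 \o Y \o mu)%VF; set B := (rho \o Z \o tau)%VF.
  (* Exchanging [C] and [D] turns either equation into the other, so this one implication serves
     both directions. *)
  have swap (C D : 'Hom(subvs_of W1, subvs_of (qrad q))) :
      C + A = D + B -> D + A = C + B.
    move=> CD; have -> : A = D + B - C by rewrite -CD addrC addKr.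
    (* The second [D] becomes [- D], so that the two copies cancel. *)
    rewrite (oppv_pchar2 C char_k) !addrA -{2}(oppv_pchar2 D char_k).
    by rewrite subrr add0r addrC.
  by split; apply: swap.
have q_psi s : q (vsval (psi s)) = q (vsval s).
  have := q_phi (vsval s + vsval (0 : subvs_of W1)).
  by rewrite block_mapE // !linear0 !addr0.
have q_mu w : q (vsval w) = q (vsval (mu w)) + q (vsval (Z w)).
  have := q_phi (vsval (0 : subvs_of (qrad q)) + vsval w).
  rewrite block_mapE // !linear0 !add0r => <-.
  (* The polar form vanishes between [psi (Z w)] and [mu w], so [q] is additive on their sum;
     [q_psi] then removes [psi]. *)
  have /(memv_qrad _ quad_q)/(_ (vsval (mu w)))/eqP := subvsP (psi (Z w)).
  by rewrite /polar -addrA -opprD subr_eq0 => /eqP ->; rewrite q_psi addrC.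
split=> [/(conjugation_fixP _ sigma_GL) | ].
  rewrite !block_map_comp // rho_inv.
  case/(block_map_inj cap0 rho_psi_GL) => comm_psi /Y_Z eqYZ comm_mu.
  (* Orthogonality of [psi] on the radical is [psi_GL] together with [q_psi]. *)
  by split=> //; [split=> // |]; apply/conjugation_fixP.
case=> [[_ /(conjugation_fixP _ rho_GL) comm_psi]].
move=> /(conjugation_fixP _ tau_GL) comm_mu [_ /Y_Z eqYZ].
apply/(conjugation_fixP _ sigma_GL).
by rewrite !block_map_comp // rho_inv comm_psi comm_mu eqYZ.
Qed.
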